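(* Let $N$ and $n$ be positive integers. Then $$ c_{N,n}=n!\,\det\left( \begin{array}{ccccc} \frac{N}{N+1}&1&&&\\ \frac{N}{N+2}&\frac{N}{N+1}&&&\\ \vdots&\vdots&\ddots&1&\\ \frac{N}{N+n-1}&\frac{N}{N+n-2}&\cdots&\frac{N}{N+1}&1\\ \frac{N}{N+n}&\frac{N}{N+n-1}&\cdots&\frac{N}{N+2}&\frac{N}{N+1} \end{array} \right), $$ i.e. $c_{N,n}=n!\det(m_{ij})_{1\le i,j\le n}$ where $m_{ij}=\frac{N}{N+i-j+1}$ for $j\le i$, $m_{i,i+1}=1$, and $m_{ij}=0$ for $j\ge i+2$.
   Context: For a positive integer $N$, the hypergeometric Cauchy numbers $c_{N,n}$ ($n\ge 0$) are defined by the formal power series identity $$\frac{1}{{}_2F_1(1,N;N+1;-x)}=\frac{(-1)^{N-1}x^N/N}{\log(1+x)-\sum_{k=1}^{N-1}(-1)^{k-1}x^k/k}=\sum_{n=0}^\infty c_{N,n}\frac{x^n}{n!},$$ where ${}_2F_1(a,b;c;z)=\sum_{n\ge0}\frac{(a)^{(n)}(b)^{(n)}}{(c)^{(n)}}\frac{z^n}{n!}$ is the Gauss hypergeometric function and $(x)^{(n)}=x(x+1)\cdots(x+n-1)$, $(x)^{(0)}=1$. In particular $c_{N,0}=1$. *)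

(* Defs.v *)
From HB Require Import structures.
From mathcomp Require Import all_boot all_order all_algebra.
From mathcomp Require Import zify.

Set Implicit Arguments.
Unset Strict Implicit.
Unset Printing Implicit Defensive.

Import Order.TTheory GRing.Theory Num.Theory.
Local Open Scope ring_scope.

(* Formal power series over the rationals, as coefficient sequences:
   f stands for \sum_n (f n) x^n. *)
Definition fps := nat -> rat.

Definition fps_one : fps := fun n => (n == 0%N)%:R.

Definition fps_mul (f g : fps) : fps :=
  fun n => \sum_(i < n.+1) f i * g (n - i)%N.

(* f(-x) *)
Definition fps_negX (f : fps) : fps := fun n => (-1) ^+ n * f n.

(* [:: g 0; ...; g n], the first coefficients of the reciprocal g of f. *)
Fixpoint fps_inv_seq (f : fps) (n : nat) : seq rat :=
  match n with
  | 0%N => [:: (f 0%N)^-1]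
  | m.+1 => let s := fps_inv_seq f m in
      rcons s (- (f 0%N)^-1 * \sum_(i < m.+1) s`_i * f (m.+1 - i)%N)
  end.

(* The reciprocal 1 / f, meaningful when f 0 != 0: see fps_mulV, fps_inv_uniq. *)
Definition fps_inv (f : fps) : fps := fun n => (fps_inv_seq f n)`_n.

(* x (x + 1) ... (x + n - 1) *)
Definition rising (x : rat) (n : nat) : rat := \prod_(i < n) (x + i%:R).

(* 2F1(a, b; c; z) as a formal power series in z. *)
Definition hyp2F1 (a b c : rat) : fps :=
  fun n => rising a n * rising b n / rising c n / n`!%:R.

(* c_{N,n}, where \sum_n c_{N,n} x^n / n! = 1 / 2F1(1, N; N + 1; -x). *)
Definition hyp_cauchy (N n : nat) : rat :=
  n`!%:R * fps_inv (fps_negX (hyp2F1 1 N%:R N.+1%:R)) n.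

(* log(1 + x) - \sum_(1 <= k < N) (-1)^(k-1) x^k / k *)
Definition fps_log1p : fps :=
  fun k => if k is k'.+1 then (-1) ^+ k' / k%:R else 0.
Definition fps_log1p_tail (N : nat) : fps :=
  fun k => fps_log1p k - (if (0 < k < N)%N then (-1) ^+ k.-1 / k%:R else 0).

Lemma size_fps_inv_seq f n : size (fps_inv_seq f n) = n.+1.
Proof. by elim: n => //= n IH; rewrite size_rcons IH. Qed.

Lemma nth_fps_inv_seq f n i :
  (i <= n)%N -> (fps_inv_seq f n)`_i = fps_inv f i.
Proof.
elim: n => [|n IH]; first by rewrite leqn0 => /eqP ->.
rewrite leq_eqVlt => /orP[/eqP -> //|lt_in].
by rewrite /= nth_rcons size_fps_inv_seq lt_in IH.
Qed.

Lemma fps_invS f n : fps_inv f n.+1 =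
  - (f 0%N)^-1 * \sum_(i < n.+1) fps_inv f i * f (n.+1 - i)%N.
Proof.
rewrite {1}/fps_inv /= nth_rcons size_fps_inv_seq ltnn eqxx.
by congr (_ * _); apply: eq_bigr => i _; rewrite nth_fps_inv_seq // -ltnS.
Qed.

Lemma fps_mulV (f : fps) : f 0%N != 0 -> fps_mul (fps_inv f) f =1 fps_one.
Proof.
move=> f0 [|n]; rewrite /fps_mul /fps_one.
  by rewrite big_ord1 /fps_inv /= mulVf.
rewrite big_ord_recr /= subnn fps_invS mulrC mulrA mulrN divff //.
by rewrite mulN1r subrr.
Qed.

Lemma fps_inv_uniq (f g : fps) :
  f 0%N != 0 -> fps_mul g f =1 fps_one -> g =1 fps_inv f.
Proof.
move=> f0 gf n; have [m] := ubnP n; elim: m n => // m IH n lt_nm.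
have := gf n; rewrite -(fps_mulV f0) /fps_mul !big_ord_recr /= subnn.
rewrite (eq_bigr (fun i : 'I_n => fps_inv f i * f (n - i)%N)) => [|i _].
  by move/addrI/(mulIf f0).
by rewrite IH // (leq_trans (ltn_ord i)).
Qed.

Lemma rising1 n : rising 1 n = n`!%:R.
Proof.
rewrite /rising; elim: n => [|n IH]; first by rewrite big_ord0.
by rewrite big_ord_recr /= IH nat1r -natrM factS mulnC.
Qed.

Lemma rising_shift (x : rat) n : x * rising (x + 1) n = rising x n * (x + n%:R).
Proof.
have -> : rising x n * (x + n%:R) = \prod_(i < n.+1) (x + i%:R).
  by rewrite big_ord_recr.
rewrite big_ord_recl addr0; congr (_ * _); apply: eq_bigr => i _.
by rewrite -addrA nat1r.
Qed.

Lemma rising_neq0 N n : (0 < N)%N -> rising N%:R n != 0.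
Proof.
move=> N0; apply/prodf_neq0 => i _.
by rewrite -natrD pnatr_eq0 addn_eq0 negb_and -lt0n N0.
Qed.

Lemma hyp2F1_coef N n : (0 < N)%N ->
  hyp2F1 1 N%:R N.+1%:R n = N%:R / (N + n)%:R.
Proof.
move=> N0; rewrite /hyp2F1 rising1.
have nf : n`!%:R != 0 :> rat by rewrite pnatr_eq0 -lt0n fact_gt0.
have r1 := @rising_neq0 N.+1 n isT.
have nN : (N + n)%:R != 0 :> rat by rewrite pnatr_eq0 addn_eq0 negb_and -lt0n N0.
rewrite -[n`!%:R * _ / _]mulrA mulrAC divff // mul1r.
apply/eqP; rewrite eqr_div //; apply/eqP.
by rewrite natrD -rising_shift natr1.
Qed.

Lemma hyp_cauchyE N : (0 < N)%N ->
  fps_mul (fun n => hyp_cauchy N n / n`!%:R)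
          (fps_negX (hyp2F1 1 N%:R N.+1%:R)) =1 fps_one.
Proof.
move=> N0 n; rewrite -(@fps_mulV (fps_negX (hyp2F1 1 N%:R N.+1%:R))).
  apply: eq_bigr => i _; congr (_ * _); rewrite /hyp_cauchy mulrAC divff ?mul1r //.
  by rewrite pnatr_eq0 -lt0n fact_gt0.
by rewrite /fps_negX hyp2F1_coef // addn0 divff ?mulr1 ?oner_eq0 // pnatr_eq0 -lt0n.
Qed.

Lemma hyp_cauchy0 N : (0 < N)%N -> hyp_cauchy N 0 = 1.
Proof.
move=> N0; have := hyp_cauchyE N0 0; rewrite /fps_mul big_ord1 /fps_negX.
rewrite hyp2F1_coef // addn0 divff ?mulr1 ?divr1 //.
by rewrite pnatr_eq0 -lt0n.
Qed.

(* The logarithmic form of the generating function. *)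
Lemma hyp_cauchy_log N : (0 < N)%N ->
  fps_mul (fun n => hyp_cauchy N n / n`!%:R) (fps_log1p_tail N)
  =1 (fun k => if k == N then (-1) ^+ N.-1 / N%:R else 0).
Proof.
move=> N0 k; have lowE j : (j < N)%N -> fps_log1p_tail N j = 0.
  by case: j => [|j] lt; rewrite /fps_log1p_tail /= ?subr0 // lt subrr.
have highE j : fps_log1p_tail N (N + j) =
    (-1) ^+ N.-1 / N%:R * fps_negX (hyp2F1 1 N%:R N.+1%:R) j.
  rewrite /fps_log1p_tail [(N + j < N)%N]ltnNge leq_addr andbF subr0.
  rewrite /fps_negX hyp2F1_coef //.
  case: N N0 {lowE} => // N _; rewrite addSn /= exprD -!mulrA; congr (_ * _).
  by rewrite mulrCA; congr (_ * _); rewrite mulKf ?pnatr_eq0.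
rewrite /fps_mul; have [lt_kN|le_Nk] := ltnP k N.
  rewrite big1 => [|i _]; first by rewrite ltn_eqF.
  by rewrite lowE ?mulr0 // (leq_ltn_trans (leq_subr _ _)).
rewrite -(big_mkord xpredT (fun i => hyp_cauchy N i / i`!%:R *
  fps_log1p_tail N (k - i)%N)) (big_cat_nat _ (n := (k - N).+1)) //=; last first.
  by rewrite ltnS leq_subr.
rewrite [X in _ + X]big_nat_cond [X in _ + X]big1 ?addr0; last first.
  by move=> i /andP[/andP[lt_i le_i] _]; rewrite lowE ?mulr0 //; lia.
rewrite big_mkord.
under eq_bigr => i _.
  have -> : (k - i = N + (k - N - i))%N by have := ltn_ord i; lia.
  rewrite highE mulrCA; over.
rewrite -mulr_sumr; have := hyp_cauchyE N0 (k - N)%N; rewrite /fps_mul => ->.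
rewrite /fps_one subn_eq0; have -> : (k <= N)%N = (k == N) by lia.
by case: eqP; rewrite ?mulr1 ?mulr0.
Qed.

(* Main.v *)
Require Import Defs.
From mathcomp Require Import all_boot all_order all_algebra.
Import GRing.Theory.
Local Open Scope ring_scope.

(** If [g] is the reciprocal of a power series [f] with constant term 1, then
    the first [n + 1] coefficients of [g] form the first column of the inverse
    of the unitriangular Toeplitz matrix [(f_(i-j))].  Its last entry is, by
    Cramer's rule, [(-1)^n] times the minor obtained by deleting the first row
    and the last column, i.e. the Hessenberg determinant [det (f_(i-j+1))].
    For [f = 2F1(1, N; N + 1; x)] one has [f_k = N / (N + k)], and the sign
    [(-1)^n] is absorbed by the substitution [x -> -x]. *)

Definition toeplitz (f : fps) n : 'M[rat]_n :=
  \matrix_(i, j) if (j <= i)%N then f (i - j)%N else 0.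

Lemma det_toeplitz (f : fps) n : \det (toeplitz f n) = f 0%N ^+ n.
Proof.
rewrite det_trig.
  under eq_bigr do rewrite mxE leqnn subnn.
  by rewrite prodr_const card_ord.
by apply/is_trig_mxP => i j lt_ij; rewrite mxE leqNgt lt_ij.
Qed.

Lemma mul_toeplitz (f g : fps) n :
  toeplitz f n *m (\col_j g j) = \col_i fps_mul g f i.
Proof.
apply/matrixP => i k; rewrite !mxE /fps_mul.
rewrite (big_ord_widen n (fun j => g j * f (i - j)%N) (ltn_ord i)).
rewrite [RHS]big_mkcond; apply: eq_bigr => j _.
by rewrite !mxE ltnS mulrC; case: leqP => _; rewrite ?mulr0.
Qed.

Lemma fps_recip_det (f g : fps) n : f 0%N = 1 -> fps_mul g f =1 fps_one ->
  g n = (-1) ^+ n *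
    \det (\matrix_(i < n, j < n) if (j <= i.+1)%N then f (i.+1 - j)%N else 0).
Proof.
move=> f0 gf; pose L := toeplitz f n.+1.
(* [L] sends the column of [g] to the first basis vector and has determinant 1, so applying [\adj L]
   recovers that column. *)
have g_adj : \col_(j < n.+1) g j = col ord0 (\adj L).
  have := mul_adj_mx L.
  rewrite det_toeplitz f0 expr1n => /(congr1 (mulmx^~ (\col_(j < n.+1) g j))).
  rewrite mul1mx => <-; rewrite -mulmxA mul_toeplitz colE; congr (_ *m _).
  by apply/matrixP => i j; rewrite !mxE gf (ord1 j) andbT.
have := congr1 (fun v : 'cV_n.+1 => v ord_max 0) g_adj.
(* Dropping row 0 turns [i - j] into [i.+1 - j]; dropping the last column keeps [j]. *)
rewrite !mxE => ->; rewrite /cofactor add0n; congr (_ * \det _).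
by apply/matrixP => i j; rewrite !mxE lift0 lift_max.
Qed.

Lemma fps_mul_negX (f g : fps) :
  fps_mul (fps_negX f) (fps_negX g) =1 fps_negX (fps_mul f g).
Proof.
move=> n; rewrite /fps_mul /fps_negX mulr_sumr; apply: eq_bigr => i _.
by rewrite mulrACA -exprD subnKC // -ltnS.
Qed.

Lemma fps_negXK (f : fps) : fps_negX (fps_negX f) =1 f.
Proof. by move=> n; rewrite /fps_negX mulrA -exprMn mulrNN mulr1 expr1n mul1r. Qed.

Lemma hyp_cauchy_negX N : (0 < N)%N ->
  fps_mul (fps_negX (fun n => hyp_cauchy N n / n`!%:R))
          (hyp2F1 1 N%:R N.+1%:R) =1 fps_one.
Proof.
move=> N_gt0 n; transitivity (fps_negX fps_one n).
  rewrite /fps_negX -(hyp_cauchyE N_gt0) -/(fps_negX _ n) -fps_mul_negX.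
  by apply: eq_bigr => i _; rewrite fps_negXK.
by case: n => [|n]; rewrite /fps_negX /fps_one ?mulr1 ?mulr0.
Qed.

Theorem theorem1 (N n : nat) (N_gt0 : (0 < N)%N) (n_gt0 : (0 < n)%N) :
  hyp_cauchy N n =
    n`!%:R *
    \det (\matrix_(i < n, j < n)
            (if (j <= i)%N then N%:R / (N + (i - j) + 1)%N%:R
             else if (j : nat) == i.+1 then 1 else 0 : rat)).
Proof.
have f0 : hyp2F1 1 N%:R N.+1%:R 0 = 1.
  by rewrite hyp2F1_coef // addn0 divff // Num.Theory.pnatr_eq0 -lt0n.
have fact_neq0 : n`!%:R != 0 :> rat.
  by rewrite Num.Theory.pnatr_eq0 -lt0n fact_gt0.
have sgn_neq0 : (-1) ^+ n != 0 :> rat by rewrite expf_neq0 // oppr_eq0 oner_eq0.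
(* Both sides carry [(-1) ^+ n], the left one from [fps_negX], so it cancels. *)
have /(mulfI sgn_neq0) := fps_recip_det _ _ n f0 (hyp_cauchy_negX _ N_gt0).
move=> /(canRL (divfK fact_neq0)) ->; rewrite mulrC; congr (_ * \det _).
apply/matrixP => i j; rewrite !mxE; case: (leqP j i) => [le_ji|lt_ij].
  by rewrite leqW // hyp2F1_coef // subSn // addnS addn1.
(* Above the diagonal, [j <= i.+1] forces [j = i.+1], where the entry is the constant term 1. *)
rewrite leq_eqVlt ltnS leqNgt lt_ij orbF.
by case: eqP => // ->; rewrite subnn f0.
Qed.
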